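(* Let $G=(V,E)$ be a finite undirected graph (unweighted, or with positive edge weights) with $n=|V|\ge 2$, and let $G'$ be obtained from $G$ by a batch of edge insertions, edge deletions and/or edge-weight changes (same node set, weights staying positive). Let $\epsilon,\delta\in(0,1)$. Suppose $r$ independent shortest paths $p_{(1)},\dots,p_{(r)}$ of $G$ were sampled according to $\pi_G$, where $r=\frac{c}{\epsilon^2}(\lfloor\log_2(\tilde{\mathit{VD}}-2)\rfloor+1+\ln\frac1\delta)$ for an upper bound $\tilde{\mathit{VD}}\ge\mathit{VD}(G)$. Construct a new sample as follows: (1) for each $k$, with $(s_k,t_k)$ the pair associated with $p_{(k)}$, replace $p_{(k)}$ by a shortest $s_k$–$t_k$ path of $G'$ chosen uniformly at random (no path if $t_k$ is unreachable from $s_k$ in $G'$); (2) let $\tilde{\mathit{VD}}'$ be an upper bound on $\mathit{VD}(G')$ and $r_{\mathrm{new}}=\frac{c}{\epsilon^2}(\lfloor\log_2(\tilde{\mathit{VD}}'-2)\rfloor+1+\ln\frac1\delta)$; if $r_{\mathrm{new}}>r$, add $r_{\mathrm{new}}-r$ further independent shortest paths of $G'$ sampled according to $\pi_{G'}$. Let $\tilde c'_B(v)$ be the fraction of paths in the new sample (of size $\max\{r,r_{\mathrm{new}}\}$) of which $v$ is an internal node, and $c'_B(v)$ the exact betweenness of $v$ in $G'$. Then $$\Pr\big(\exists v\in V:\ |c'_B(v)-\tilde c'_B(v)|>\epsilon\big)<\delta.$$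
   Context: The vertex diameter $\mathit{VD}(H)$ of a graph $H$ is the maximum, over all shortest paths of $H$, of the number of nodes on the path. Normalized betweenness: $c_B(v)=\frac{1}{n(n-1)}\sum_{s\neq v\neq t}\frac{\sigma_{st}(v)}{\sigma_{st}}$, where $\sigma_{st}$ is the number of shortest $s$–$t$ paths and $\sigma_{st}(v)$ the number of them passing through $v$ (terms with $\sigma_{st}=0$ are $0$). Sampling according to $\pi_H$: choose an ordered pair $(s,t)$ of distinct nodes uniformly at random, then (if $t$ is reachable from $s$) a shortest $s$–$t$ path uniformly at random; so each shortest path $p_{st}$ of $H$ has probability $\frac{1}{n(n-1)\sigma_{st}}$. The constant $c\approx0.5$ is the universal constant of the Riondato–Kornaropoulos sample-size bound: if $r\ge\frac{c}{\epsilon^2}(\lfloor\log_2(\mathit{VD}(H)-2)\rfloor+1+\ln\frac1\delta)$ independent paths are sampled according to $\pi_H$ and $\tilde c_B(v)$ is the fraction having $v$ as internal node, then $\Pr(\exists v:|c_B(v)-\tilde c_B(v)|>\epsilon)<\delta$. Sample sizes are understood as integers. *)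

(* Defs.v *)
From HB Require Import structures.
From mathcomp Require Import all_boot all_order all_algebra.
From mathcomp Require Import reals exp.

Set Implicit Arguments.
Unset Strict Implicit.
Unset Printing Implicit Defensive.

Import Order.TTheory GRing.Theory Num.Theory.
Local Open Scope ring_scope.

(* Finite simple undirected graphs with positive edge weights: [wt x y] is
   [None] when {x, y} is not an edge, and [Some w] when it is an edge of
   weight w. Unweighted graphs are those whose edges all have weight 1. *)
Record wgraph (R : realType) (V : finType) := WGraph {
  wt :> V -> V -> option R;
  wt_sym : forall x y, wt x y = wt y x;
  wt_irr : forall x, wt x x = None;
  wt_pos : forall x y w, wt x y = Some w -> 0 < w }.

Definition same_pair (V : finType) (u v x y : V) : bool :=
  ((x == u) && (y == v)) || ((x == v) && (y == u)).

(* The positivity of the new weights, and u != v for an inserted edge, are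
   enforced by G' being a [wgraph]. *)
Variant edge_update (R : realType) (V : finType) (G G' : wgraph R V) : Prop :=
| EdgeInsertion (u v : V) (w : R) of
    G u v = None &
    (forall x y, G' x y = if same_pair u v x y then Some w else G x y)
| EdgeDeletion (u v : V) (w : R) of
    G u v = Some w &
    (forall x y, G' x y = if same_pair u v x y then None else G x y)
| WeightChange (u v : V) (w w' : R) of
    G u v = Some w &
    (forall x y, G' x y = if same_pair u v x y then Some w' else G x y).

Inductive batch (R : realType) (V : finType) (G : wgraph R V) :
    wgraph R V -> Prop :=
| BatchNil : batch G G
| BatchRcons (G1 G2 : wgraph R V) of batch G G1 & edge_update G1 G2 :
    batch G G2.

(* Paths are lists of pairwise distinct nodes, hence have at most #|V| nodes;
   the bounded-length type makes the set of all paths finite. *)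
Notation node_list V := (#|V|.-bseq V).

Section ShortestPaths.
Variables (R : realType) (V : finType) (G : wgraph R V).

Definition edge : rel V := fun x y => isSome (G x y).

Definition is_path (s t : V) (p : seq V) : bool :=
  if p is x :: q then [&& x == s, path edge x q, last x q == t & uniq p]
  else false.

Definition path_length (p : seq V) : R :=
  \sum_(e <- zip p (behead p)) odflt 0 (G e.1 e.2).

Definition shortest (s t : V) (p : node_list V) : bool :=
  is_path s t p &&
  [forall q : node_list V, is_path s t q ==> (path_length p <= path_length q)].

Definition sigma (s t : V) : nat := #|[set p | shortest s t p]|.

Definition sigma_through (s t v : V) : nat :=
  #|[set p : node_list V | shortest s t p & v \in p]|.

Definition VD : nat :=
  \max_(p : node_list V | [exists s, exists t, shortest s t p]) size p.

(* Terms with [sigma s t = 0] vanish since 0^-1 = 0. *)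
Definition betweenness (v : V) : R :=
  (#|V| * #|V|.-1)%:R^-1 *
  \sum_(s | s != v) \sum_(t | t != v)
     (sigma_through s t v)%:R / (sigma s t)%:R.

End ShortestPaths.

(* A draw ((s, t), o) is a sampled ordered pair of nodes with a shortest s-t
   path, o = None meaning that t is not reachable from s. *)
Notation draw V := ((V * V) * option (node_list V))%type.

Definition path_law (R : realType) (V : finType) (G : wgraph R V)
    (st : V * V) (o : option (node_list V)) : R :=
  match o with
  | Some p => if shortest G st.1 st.2 p then (sigma G st.1 st.2)%:R^-1 else 0
  | None => (sigma G st.1 st.2 == 0%N)%:R
  end.

Definition pair_law (R : realType) (V : finType) (st : V * V) : R :=
  if st.1 != st.2 then (#|V| * #|V|.-1)%:R^-1 else 0.

(* The sampling distribution pi_G. *)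
Definition draw_law (R : realType) (V : finType) (G : wgraph R V)
    (d : draw V) : R :=
  pair_law R d.1 * path_law G d.1 d.2.

Definition iid (R : realType) (T : finType) (mu : T -> R) (n : nat)
    (x : n.-tuple T) : R :=
  \prod_(i < n) mu (tnth x i).

Definition Pr (R : realType) (T : finType) (mu : T -> R) (A : pred T) : R :=
  \sum_(x | A x) mu x.

Definition internal (V : finType) (v : V) (d : draw V) : bool :=
  if d.2 is Some p then [&& v \in p, v != d.1.1 & v != d.1.2] else false.

Definition estimate (R : realType) (V : finType) (S : seq (draw V)) (v : V) :
    R :=
  (count (internal v) S)%:R / (size S)%:R.

Definition bad_sample (R : realType) (V : finType) (G : wgraph R V) (eps : R)
    (S : seq (draw V)) : bool :=
  [exists v : V, eps < `|betweenness G v - estimate R S v|].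

(* (c / eps^2) (floor (log2 (D - 2)) + 1 + ln (1 / delta)).
   [trunc_log 2 m] is the integer part of log2 m for m > 0, and 0 for m = 0;
   thus the logarithm is read as 0 for D <= 2, where no shortest path has an
   internal node. *)
Definition size_bound (R : realType) (c eps delta : R) (D : nat) : R :=
  c / eps ^+ 2 * ((trunc_log 2 (D - 2))%:R + 1 + ln (1 / delta)).

Definition sample_size (R : realType) (c eps delta : R) (D : nat) : nat :=
  `|Num.ceil (size_bound c eps delta D)|%N.

(* c is a universal constant for the Riondato-Kornaropoulos bound. *)
Definition RK_constant (R : realType) (c : R) : Prop :=
  0 < c /\
  forall (V : finType) (H : wgraph R V) (eps delta : R) (r : nat),
    (2 <= #|V|)%N -> 0 < eps < 1 -> 0 < delta < 1 ->
    size_bound c eps delta (VD H) <= r%:R ->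
    Pr (@iid R _ (draw_law H) r) (fun S => bad_sample H eps S) < delta.

Section Update.
Variables (R : realType) (V : finType) (G G' : wgraph R V) (r m : nat).

(* Outcomes of the whole procedure: the r initial draws, the r replacement
   paths, and the m additional draws. *)
Definition outcome : finType :=
  (r.-tuple (draw V) * r.-tuple (option (node_list V)) *
   m.-tuple (draw V))%type.

(* The initial draws are i.i.d. from pi_G; given them, the k-th replacement
   path is drawn uniformly among the shortest s_k-t_k paths of G',
   independently over k; the additional draws are i.i.d. from pi_G' and
   independent of everything else. *)
Definition outcome_law (w : outcome) : R :=
  let: (old, repl, extra) := w in
  iid (draw_law G) old *
  \prod_(k < r) path_law G' (tnth old k).1 (tnth repl k) *
  iid (draw_law G') extra.

Definition new_sample (w : outcome) : seq (draw V) :=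
  let: (old, repl, extra) := w in
  [seq ((tnth old k).1, tnth repl k) | k <- enum 'I_r] ++ extra.

End Update.

(* Main.v *)
Require Import Defs.
From HB Require Import structures.
From mathcomp Require Import all_boot all_order all_algebra.
From mathcomp Require Import reals exp.

Set Implicit Arguments.
Unset Strict Implicit.
Unset Printing Implicit Defensive.

Import Order.TTheory GRing.Theory Num.Theory.
Local Open Scope ring_scope.

(* The pair (s_k, t_k) of an initial draw is uniform whatever the graph, since
   the conditional law of the path given the pair has total mass 1. Replacing
   the path by a uniform shortest s_k-t_k path of G' therefore turns a draw from
   pi_G into a draw from pi_G', and independence is preserved: the new sample
   consists of max(r, r_new) i.i.d. draws from pi_G'. As r_new is at least the
   Riondato-Kornaropoulos size for G', their bound applies. *)

Section IndependentDraws.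
Variable R : realType.

Lemma big_tuple_prod (T : finType) (n : nat) (F : 'I_n -> T -> R) :
  \sum_(x : n.-tuple T) \prod_(i < n) F i (tnth x i) =
  \prod_(i < n) \sum_(t : T) F i t.
Proof.
rewrite bigA_distr_bigA.
rewrite (reindex (fun f : {ffun 'I_n -> T} => [tuple f i | i < n])) /=.
  by apply: eq_bigr => f _; apply: eq_bigr => i _; rewrite tnth_mktuple.
exists (fun x : n.-tuple T => [ffun i => tnth x i]) => [f _ | x _].
  by apply/ffunP => i; rewrite ffunE tnth_mktuple.
by apply: eq_from_tnth => i; rewrite tnth_mktuple ffunE.
Qed.

(** A coordinatewise map sends a product law to the product of the image laws: the fibre of
    [map_tuple f] over [y] is the product of the fibres of [f] over the entries of [y], so its mass
    factorizes. *)
Lemma sum_iid_map (T U : finType) (f : T -> U) (mu : T -> R) (n : nat)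
    (F : n.-tuple U -> R) :
  \sum_(x : n.-tuple T) iid mu x * F (map_tuple f x) =
  \sum_(y : n.-tuple U) iid (fun u => \sum_(t | f t == u) mu t) y * F y.
Proof.
rewrite (partition_big (map_tuple f) xpredT) //=.
apply: eq_bigr => y _.
rewrite (eq_bigr (fun x => iid mu x * F y)) => [|x /eqP <- //].
rewrite -big_distrl /=; congr (_ * _).
rewrite /iid; under [RHS]eq_bigr => i _ do rewrite big_mkcond /=.
rewrite -big_tuple_prod [LHS]big_mkcond; apply: eq_bigr => x _.
case: eqP => [<-|neq].
  by apply: eq_bigr => i _; rewrite tnth_map eqxx.
(* Outside the fibre some coordinate disagrees, and its factor on the right is already 0. *)
have /existsP[i ne_i] : [exists i, f (tnth x i) != tnth y i].
  rewrite -negb_forall; apply/negP => /forallP eq_f; apply: neq.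
  by apply: eq_from_tnth => i; rewrite tnth_map; apply/eqP.
by rewrite (bigD1 i) //= (negPf ne_i) mul0r.
Qed.

Lemma sum_tuple_zip (T U : finType) (n : nat)
    (F : n.-tuple T -> n.-tuple U -> R) :
  \sum_(x : n.-tuple T) \sum_(y : n.-tuple U) F x y =
  \sum_(z : n.-tuple (T * U)) F (map_tuple fst z) (map_tuple snd z).
Proof.
rewrite pair_bigA /=.
rewrite (reindex (fun z : n.-tuple (T * U) =>
                    (map_tuple fst z, map_tuple snd z))) //=.
exists (fun p => zip_tuple p.1 p.2) => [z _ | [x y] _] /=.
  by apply: val_inj => /=; rewrite zip_unzip.
by congr pair; apply: val_inj => /=;
   rewrite -/unzip1 -/unzip2 ?unzip1_zip ?unzip2_zip ?size_tuple.
Qed.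

Lemma sum_iid_cat (T : finType) (mu : T -> R) (n m : nat) (F : seq T -> R) :
  \sum_(x : n.-tuple T) \sum_(y : m.-tuple T) iid mu x * iid mu y * F (x ++ y) =
  \sum_(z : (n + m).-tuple T) iid mu z * F z.
Proof.
rewrite pair_bigA /=.
rewrite [RHS](reindex (fun p : n.-tuple T * m.-tuple T =>
                         cat_tuple p.1 p.2)) /=; last first.
  exists (fun z : (n + m).-tuple T =>
            ([tuple tnth z (lshift m i) | i < n],
             [tuple tnth z (rshift n i) | i < m])) => [[x y] _ | z _] /=.
    by congr (_, _); apply: eq_from_tnth => i;
       rewrite tnth_mktuple ?tnth_lshift ?tnth_rshift.
  apply: eq_from_tnth => i; rewrite -(splitK i).
  by case: (split i) => j /=; rewrite ?tnth_lshift ?tnth_rshift tnth_mktuple.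
apply: eq_bigr => -[x y] _ /=; congr (_ * _).
rewrite /iid big_split_ord /=; congr (_ * _); apply: eq_bigr => i _.
  by rewrite tnth_lshift.
by rewrite tnth_rshift.
Qed.

End IndependentDraws.

Section Resampling.
Variables (R : realType) (V : finType).

Lemma sum_path_law (G : wgraph R V) (st : V * V) :
  \sum_(o : option (node_list V)) path_law G st o = 1.
Proof.
rewrite (bigD1 None) //= (reindex_omap Some id) /=; last by case.
rewrite (eq_bigl xpredT) => [|p]; last by rewrite eqxx.
rewrite -big_mkcond /= sumr_const.
have -> : #|[pred p | shortest G st.1 st.2 p]| = sigma G st.1 st.2.
  by rewrite /sigma cardsE.
(* With no shortest path all the mass sits on [None]; otherwise [None] has mass 0 and [k.+1] paths
   have mass [k.+1%:R^-1] each. *)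
case: (sigma G st.1 st.2) => [|k]; first by rewrite mulr0n addr0.
by rewrite add0r -[_ ^-1 *+ _]mulr_natl mulfV ?pnatr_eq0.
Qed.

Lemma resampled_draw_law (G G' : wgraph R V) (d' : draw V) :
  \sum_(z : draw V * option (node_list V) | (z.1.1, z.2) == d')
     draw_law G z.1 * path_law G' z.1.1 z.2 = draw_law G' d'.
Proof.
case: d' => st' o'.
rewrite big_mkcond -(pair_bigA _ (fun d o => if (d.1, o) == (st', o')
  then draw_law G d * path_law G' d.1 o else 0)) /=.
rewrite -(pair_bigA _ (fun st p => \sum_o if (st, o) == (st', o')
  then draw_law G (st, p) * path_law G' st o else 0)) /=.
rewrite (bigD1 st') //= [X in _ + X]big1 ?addr0 => [|st ne_st]; last first.
  rewrite big1 // => p _; rewrite big1 // => o _.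
  by rewrite xpair_eqE (negPf ne_st).
(* The constraint fixes the pair and the new path; only the old path [p] stays free, and it is then
   summed out to 1. *)
transitivity (\sum_p pair_law R st' * path_law G st' p * path_law G' st' o').
  apply: eq_bigr => p _; rewrite (bigD1 o') //= eqxx.
  rewrite [X in _ + X]big1 ?addr0 // => o ne_o.
  by rewrite xpair_eqE (negPf ne_o) andbF.
by rewrite -big_distrl -big_distrr /= sum_path_law mulr1.
Qed.

Lemma Pr_new_sample (G G' : wgraph R V) (r m : nat) (A : pred (seq (draw V))) :
  Pr (@outcome_law R V G G' r m) (fun w => A (new_sample w)) =
  Pr (@iid R _ (draw_law G') (r + m)) (fun S => A S).
Proof.
rewrite /Pr big_mkcond [RHS]big_mkcond /=.
(* The event becomes an indicator weight, the form to which the summation lemmas apply. *)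
transitivity (\sum_(z : (r + m).-tuple (draw V))
    iid (draw_law G') z * (A z)%:R); last first.
  by apply: eq_bigr => z _; case: (A z); rewrite ?mulr1 ?mulr0.
rewrite -(sum_iid_cat (draw_law G') r m (fun s => (A s)%:R)).
(* [mu] is the joint law of an old draw and its replacement path; [f] forgets the old path. *)
pose f (z : draw V * option (node_list V)) : draw V := (z.1.1, z.2).
pose mu z := draw_law G z.1 * path_law G' z.1.1 z.2.
transitivity (\sum_(y : r.-tuple (draw V)) iid (draw_law G') y *
    \sum_(e : m.-tuple (draw V)) iid (draw_law G') e * (A (y ++ e))%:R);
  last first.
  by apply: eq_bigr => y _; rewrite big_distrr; apply: eq_bigr => e _ /=;
     rewrite mulrA.
(* The [r] draws from [draw_law G'] are realized as images under [f] of draws from [mu]. *)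
transitivity (\sum_(z : r.-tuple _) iid mu z *
    \sum_(e : m.-tuple (draw V)) iid (draw_law G') e *
       (A (map_tuple f z ++ e))%:R); last first.
  rewrite (sum_iid_map f mu (fun y => \sum_(e : m.-tuple (draw V))
    iid (draw_law G') e * (A (y ++ e))%:R)).
  apply: eq_bigr => y _; congr (_ * _); apply: eq_bigr => i _.
  exact: resampled_draw_law.
pose H old repl (e : m.-tuple (draw V)) :=
  @outcome_law R V G G' r m (old, repl, e) *
  (A (@new_sample V r m (old, repl, e)))%:R.
transitivity (\sum_old \sum_repl \sum_e H old repl e).
  rewrite pair_bigA /= pair_bigA /=; apply: eq_bigr => -[[old repl] e] _ /=.
  by rewrite /H; case: (A _); rewrite ?mulr1 ?mulr0.
rewrite sum_tuple_zip; apply: eq_bigr => z _.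
rewrite big_distrr; apply: eq_bigr => e _ /=.
rewrite /H /outcome_law /new_sample mulrA; congr (_ * _ * _).
  rewrite /iid -big_split /=; apply: eq_bigr => i _.
  by rewrite !tnth_map.
congr ((A (_ ++ _))%:R).
rewrite /= -[in RHS](map_tnth_enum z) -[RHS]map_comp.
by apply: eq_map => i; rewrite /f /= !tnth_map.
Qed.

End Resampling.

(** Passes from the exact vertex diameter in [RK_constant] to the upper bound that fixes the sample
    size. *)
Lemma size_bound_homo (R : realType) (c eps delta : R) (D D' : nat) :
  0 <= c -> (D <= D')%N ->
  size_bound c eps delta D <= size_bound c eps delta D'.
Proof.
move=> c_ge0 le_D; rewrite /size_bound ler_wpM2l //.
  by rewrite divr_ge0 // exprn_even_ge0.
by rewrite !lerD2r ler_nat leq_trunc_log // leq_sub2r.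
Qed.

Lemma size_bound_le_sample_size (R : realType) (c eps delta : R) (D : nat) :
  size_bound c eps delta D <= (sample_size c eps delta D)%:R.
Proof.
apply: le_trans (ceil_ge _) _.
(* The absolute value only enlarges the ceiling, whatever its sign. *)
by rewrite pmulrn ler_int lez_abs.
Qed.

Theorem theorem3 (R : realType) (c : R) (hc : RK_constant c)
    (V : finType) (hV : (2 <= #|V|)%N)
    (G G' : wgraph R V) (hGG' : batch G G')
    (eps delta : R) (heps : 0 < eps < 1) (hdelta : 0 < delta < 1)
    (D D' : nat) (hD : (VD G <= D)%N) (hD' : (VD G' <= D')%N)
    (r rnew : nat)
    (hr : r = sample_size c eps delta D)
    (hrnew : rnew = sample_size c eps delta D') :
  Pr (@outcome_law R V G G' r (rnew - r))
     (fun w => bad_sample G' eps (new_sample w)) < delta.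
Proof.
have [c_gt0 RK] := hc.
rewrite (Pr_new_sample _ _ _ _ (bad_sample G' eps)); apply: RK => //.
apply: le_trans (size_bound_homo eps delta (ltW c_gt0) hD') _.
apply: le_trans (size_bound_le_sample_size _ _ _ _) _.
(* Subtraction is truncated, so [r + (rnew - r)] is the maximum of [r] and [rnew]. *)
by rewrite -hrnew ler_nat -leq_subLR.
Qed.
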